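(* Fix $p\in(1,+\infty)$ and $\alpha>0$, and let $n\to\infty$. Then $$\log\|T_\alpha^n\|_{p,p}=\begin{cases} n\log(1-\alpha)+o_{p,\alpha}(n) & \text{if }\alpha<1,\\ -n\log n+O_p(n) & \text{if }\alpha=1,\\ -\frac12 n^2\log\alpha+O_{p,\alpha}(n) & \text{if }\alpha>1.\end{cases}$$
   Context: For real $\alpha>0$, $T_\alpha\colon L^p[0,1]\to L^p[0,1]$ is the bounded linear operator $(T_\alpha f)(x):=\int_0^{x^\alpha} f(y)\,dy$, and $T_\alpha^n$ is its $n$-th iterate. $\|\cdot\|_{p,p}$ is the operator norm on $L^p[0,1]$. The symbols $O$ and $o$ are Landau symbols as $n\to\infty$; subscripts indicate the parameters on which the implied constants or rates may depend. *)

(* Defs.v *)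
From HB Require Import structures.
From mathcomp Require Import all_boot all_order all_algebra.
From mathcomp Require Import all_classical all_reals all_analysis.

Set Implicit Arguments.
Unset Strict Implicit.
Unset Printing Implicit Defensive.
Import Order.TTheory GRing.Theory Num.Theory.
Import numFieldNormedType.Exports.

Local Open Scope classical_set_scope.
Local Open Scope ring_scope.

(* L^p[0,1] is L^p of the real line for this measure: a function is only seen
   through its almost-everywhere class on [0,1]. *)
Definition lebesgue01 (R : realType) : {measure set (measurableTypeR R) -> \bar R} :=
  mrestr (@lebesgue_measure R) (measurable_itv `[0, 1]).

(* Elements of L^p are handled through representatives; the norm of a
   representative is that of its class. The supremum is +oo if A is unbounded. *)
Definition opnorm d (T : measurableType d) (R : realType)
    (mu : {measure set T -> \bar R}) (p : \bar R)
    (A : (T -> R) -> (T -> R)) : \bar R :=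
  ereal_sup [set 'N[mu]_p[EFin \o A f]%E | f in
    [set f : T -> R | f \in Lfun mu p /\ ('N[mu]_p[EFin \o f] <= 1)%E]].

(* Integrating against lebesgue01 rather than the Lebesgue measure changes
   nothing for x in [0,1], and makes the operator compatible with almost
   everywhere equality on [0,1]. *)
Definition volterra (R : realType) (alpha : R)
    (f : measurableTypeR R -> R) : measurableTypeR R -> R :=
  fun x => \int[@lebesgue01 R]_(y in `[0, x `^ alpha]) f y.

(* Main.v *)
Require Import Defs.
From mathcomp Require Import all_boot all_order all_algebra.
From mathcomp Require Import all_classical all_reals all_analysis.
From mathcomp Require Import measurable_realfun.
From mathcomp Require Import lra ring.
Set Implicit Arguments.
Unset Strict Implicit.
Unset Printing Implicit Defensive.
Import Order.TTheory GRing.Theory Num.Theory.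
Import numFieldNormedType.Exports.
Local Open Scope classical_set_scope.
Local Open Scope ring_scope.

(** Write T for the operator and g_k = 1 + alpha + ... + alpha^k, so that
    g_(k+1) = alpha g_k + 1. Integrating a power up to x^alpha gives
    T(x^(g_k - 1)) = x^(g_(k+1) - 1) / g_k, hence on [0,1]
      T^n 1 = P_n x^(g_n - 1)   where   P_n = 1 / (g_0 ... g_(n-1)).
    These powers control the whole norm, for two reasons. The constant 1 has
    norm 1 in every L^p of a probability measure, and an L^p norm dominates
    the L^1 norm, so that |T^n| >= int_0^1 T^n 1 = P_(n+1) (opnorm_ge).
    Conversely |T f| <= |f|_1 <= |f|_p pointwise, so T sends the unit ball of
    L^p below the constant 1; as T is positive, T^(n+1) f is then dominated by
    T^n 1 <= P_n (opnorm_le).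

    Thus P_(n+1) <= |T^n| <= P_(n-1), and log |T^n| is - sum_(k < n) log g_k
    up to an error log g_n (ln_opnorm_bound). This error is bounded for
    alpha < 1, is log (n + 1) for alpha = 1 and is O(n) for alpha > 1, so in
    each regime only the sum remains:
    - for alpha < 1, g_k = (1 - alpha^(k+1)) / (1 - alpha), and the
      logarithms of the numerators have a bounded sum (log_sum_lt1), so that
      the error term is even O(1);
    - for alpha = 1, g_k = k + 1 and the sum is log n! (log_sum_eq1);
    - for alpha > 1, g_k lies between alpha^k and a constant multiple of
      alpha^k, and the exponents k add up to n (n - 1) / 2 (log_sum_gt1). *)

(** * Norms over a probability measure *)

Section ProbabilityNorms.
Context d (T : measurableType d) (R : realType).
Variable mu : {measure set T -> \bar R}.
Hypothesis mu1 : mu setT = 1%E.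

(** Hoelder's inequality against the constant 1. *)
Lemma Lnorm1_le_Lnorm (p : R) (f : T -> R) :
  1 < p -> measurable_fun setT f ->
  ('N[mu]_1[EFin \o f] <= 'N[mu]_p%:E[EFin \o f])%E.
Proof.
move=> p1 mf; have p0 : 0 < p by lra.
have q0 : 0 < 1 - p^-1 by rewrite subr_gt0 invf_lt1.
have := @hoelder _ _ _ mu f (cst 1) p (1 - p^-1)^-1 mf.
rewrite invrK subrKC invr_gt0 => /(_ (measurable_cst _) p0 q0 erefl).
rewrite Lnorm_cst1 mu1 poweR1r mule1; apply: le_trans.
by under [leRHS]eq_Lnorm do rewrite /= mulr1.
Qed.

Lemma Lnorm_le_ae (p c : R) (f : T -> R) :
  0 < p -> 0 <= c -> measurable_fun setT f ->
  {ae mu, forall x, `|f x| <= c} ->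
  ('N[mu]_p%:E[EFin \o f] <= c%:E)%E.
Proof.
move=> p0 c0 mf fc.
have -> : c%:E = ((c%:E `^ p) `^ p^-1)%E.
  by rewrite -poweRrM divff ?gt_eqF// poweRe1.
rewrite unlock; apply: gt0_ler_poweR.
- by rewrite invr_ge0 ltW.
- by rewrite in_itv/= leey integral_ge0.
- by rewrite in_itv/= leey lee_fin powR_ge0.
rewrite [leRHS](_ : _ = \int[mu]_(x in setT) (c%:E `^ p))%E; last first.
  by rewrite poweR_EFin integral_cst// mu1 mule1.
apply: ae_ge0_le_integral => //.
- by move=> x _; exact: poweR_ge0.
- apply: (measurableT_comp (measurable_poweR _)) => //.
  by do 2 apply: measurableT_comp => //.
- by move=> x _; rewrite lee_fin powR_ge0.
- apply: filterS fc => x fx _ /=.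
  by rewrite lee_fin ge0_ler_powR// ?nnegrE// ltW.
Qed.

Lemma bounded_integrable (f : T -> R) (c : R) :
  measurable_fun setT f -> (forall x, `|f x| <= c) ->
  mu.-integrable setT (EFin \o f).
Proof.
move=> mf fc; apply: measurable_bounded_integrable => //.
  by rewrite mu1 ltry.
by exists c; split; [exact: num_real|move=> M cM x _; exact: le_trans (ltW cM)].
Qed.

End ProbabilityNorms.

(** * Integrals over [0, t] *)

Section UnitInterval.
Context {R : realType}.
Notation mu := (@lebesgue01 R).

Lemma lebesgue01E A : mu A = @lebesgue_measure R (A `&` `[0, 1]).
Proof. by []. Qed.

(** The canonical measurable structure of R and the one carried by the Lebesgue
    measure have the same measurable sets but different displays; this restates
    measurable_itv for the latter. *)
Lemma measurable_itvR (i : interval R) :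
  measurable ([set` i] : set (measurableTypeR R)).
Proof. exact: measurable_itv. Qed.

Lemma lebesgue01_setT : mu setT = 1%E.
Proof.
rewrite lebesgue01E setTI lebesgue_measure_itv/= lte_fin ltr01.
by rewrite -EFinB subr0.
Qed.

Lemma ae_unit_interval : {ae mu, forall x, x \in `[0, 1]}.
Proof.
exists (~` `[0, 1]); split; first exact: measurableC.
  by rewrite lebesgue01E setICl measure0.
by move=> x /= /negP; rewrite in_itv/= => h k; apply: (negP h).
Qed.

(** The exponent is written s - 1 because the iterates of the operator produce
    powers of this form. The case s = 1 relies on 0 `^ 0 = 1: the integrand is
    then constant, hence continuous at 0, as for s > 1. *)
Lemma integral_powR (t s : R) : 0 <= t <= 1 -> 1 <= s ->
  \int[mu]_(y in `[0, t]) (y `^ (s - 1)) = t `^ s / s.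
Proof.
move=> /andP[t0 t1] s1.
have s0 : 0 < s by lra.
(* On subsets of [0, t] the restricted measure is the Lebesgue measure. *)
rewrite /Rintegral (eq_measure_integral lebesgue_measure); last first.
  move=> A mA A0t; rewrite lebesgue01E setIidl//.
  by move=> x /A0t/=; rewrite !in_itv/= => /andP[-> /le_trans]; apply.
have [->|tn0] := eqVneq t 0.
  by rewrite set_itv1 integral_set1 powR0 ?mul0r// gt_eqF.
have {tn0} {}t0 : 0 < t by rewrite lt_neqAle eq_sym tn0.
have cvg0 (r : R) : 0 <= r -> a `^ r @[a --> 0^'+] --> (0 : R) `^ r.
  rewrite le_eqVlt => /predU1P[<-|r0].
    by under eq_fun do rewrite powRr0; rewrite powRr0; exact: cvg_cst.
  by rewrite powR0 ?gt_eqF//; exact: powR_cvg0.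
have cpow (r x : R) : 0 < x -> {for x, continuous (@powR R ^~ r)}.
  move=> x0; apply/differentiable_continuous/derivable1_diffP.
  by apply: derivable_powR; rewrite in_itv/= x0.
rewrite (@continuous_FTC2 _ _ (fun x => x `^ s / s))//.
- by rewrite /= powR0 ?gt_eqF// mul0r subr0.
- apply/continuous_within_itvP => //; split.
  + by move=> x; rewrite in_itv/= => /andP[x0 _]; exact: cpow.
  + by apply: cvg0; lra.
  + by apply: cvg_at_left_filter; exact: cpow.
- split.
  + move=> x; rewrite in_itv/= => /andP[x0 _].
    apply: derivableM => //.
    by apply: derivable_powR; rewrite in_itv/= x0.
  + by apply: cvgMl; apply: cvg0; lra.
  + by apply: cvgMl; apply: cvg_at_left_filter; exact: cpow.
- move=> x; rewrite in_itv/= => /andP[x0 _].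
  have h : is_derive x (1 : R) (fun x : R => x `^ s / s) (x `^ (s - 1)).
    have h0 := @is_derive1_powR R s x x0.
    have h1 : is_derive x (1 : R) (cst s^-1 : R -> R) 0 by exact: is_derive_cst.
    apply: (is_derive_eq (is_deriveM h0 h1)) => /=.
    by rewrite scaler0 add0r /GRing.scale/= mulrA mulVf ?mul1r// gt_eqF.
  by rewrite derive1E derive_val.
Qed.

End UnitInterval.

(** * The operator and the powers of x *)

Section Volterra.
Context {R : realType}.
Notation mu := (@lebesgue01 R).
Variable alpha : R.
Hypothesis alpha0 : 0 < alpha.
Notation T := (@volterra R alpha).

(** This bound, valid at every real x, is what keeps all the iterates integrable
    and lets constants dominate them. *)
Lemma volterra_le_norm1 (f : measurableTypeR R -> R) x :
  mu.-integrable setT (EFin \o f) ->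
  `|T f x| <= fine 'N[mu]_1[EFin \o f].
Proof.
move=> intf.
have intD : mu.-integrable `[0, x `^ alpha] (EFin \o f).
  by apply: (integrableS measurableT (measurable_itvR _)) intf.
apply: (le_trans (le_normr_Rintegral (measurable_itvR _) intD)).
have /integrableP[mf ffin] := intf.
rewrite Lnorm1 /Rintegral fine_le//.
- rewrite ge0_fin_numE; last by apply: integral_ge0 => y _; rewrite lee_fin.
  by have /integrableP[_] := intD.
- by rewrite ge0_fin_numE//; apply: integral_ge0.
- apply: ge0_subset_integral => //.
  exact: (measurableT_comp (@abse_measurable _ setT) mf).
Qed.

(** Integrals of a nonnegative function over [0, t] are nondecreasing in t, hence
    measurable in t, and f = (f + |f|) - |f| is a difference of two nonnegative
    integrable functions. *)
Lemma measurable_volterra (f : measurableTypeR R -> R) :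
  mu.-integrable setT (EFin \o f) -> measurable_fun setT (T f).
Proof.
move=> intf.
have mono (h : measurableTypeR R -> R) : mu.-integrable setT (EFin \o h) ->
    (forall x, 0 <= h x) ->
    measurable_fun setT (fun t : R => \int[mu]_(y in `[0, t]) h y).
  move=> inth h0; apply: nondecreasing_measurable => // s t st.
  rewrite /Rintegral fine_le//.
  - apply: integrable_fin_num => //.
    exact: (integrableS measurableT (measurable_itvR _)) inth.
  - apply: integrable_fin_num => //.
    exact: (integrableS measurableT (measurable_itvR _)) inth.
  - apply: ge0_subset_integral => //.
    + by have /integrableP[/measurable_funTS] := inth.
    + by move=> y _; rewrite lee_fin.
    + by apply: subset_itvl; rewrite bnd_simp.
have intn : mu.-integrable setT (EFin \o (fun x => `|f x|)).
  exact: integrable_abse intf.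
have intD : mu.-integrable setT (EFin \o (fun x => f x + `|f x|)).
  exact: integrableD intf intn.
rewrite (_ : T f = (fun t : R => \int[mu]_(y in `[0, t]) (f y + `|f y|) -
    \int[mu]_(y in `[0, t]) `|f y|) \o (@powR R ^~ alpha)); last first.
  apply/funext => x /=; rewrite /volterra RintegralD//.
  - by rewrite addrK.
  - exact: (integrableS measurableT (measurable_itvR _)) intf.
  - exact: (integrableS measurableT (measurable_itvR _)) intn.
apply: measurableT_comp; last exact: measurable_powR.
apply: measurable_funB; apply: mono => // x.
by rewrite -lerBlDl sub0r -normrN ler_norm.
Qed.

Lemma volterra_integrable (f : measurableTypeR R -> R) :
  mu.-integrable setT (EFin \o f) -> mu.-integrable setT (EFin \o T f).
Proof.
move=> intf.
apply: (bounded_integrable lebesgue01_setT (measurable_volterra intf)) => x.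
exact: volterra_le_norm1.
Qed.

Lemma powR_unit_interval (r x : R) : 0 <= r -> 0 <= x <= 1 -> 0 <= x `^ r <= 1.
Proof.
move=> r0 /andP[x0 x1]; rewrite powR_ge0/=.
suff : x `^ r <= 1 `^ r by rewrite powR1.
by rewrite ge0_ler_powR// nnegrE.
Qed.

Lemma powR_integrable (s t : R) : 1 <= s -> t <= 1 ->
  mu.-integrable `[0, t] (EFin \o (@powR R ^~ (s - 1))).
Proof.
move=> s1 t1; apply: measurable_bounded_integrable => //.
- apply: (@le_lt_trans _ _ (mu setT)); last by rewrite lebesgue01_setT ltry.
  by apply: le_measure; rewrite ?inE.
- by apply: measurable_funTS; exact: measurable_powR.
- exists 1; split; [exact: num_real|move=> M M1 y /=].
  rewrite in_itv/= => /andP[y0 yx]; rewrite ger0_norm ?powR_ge0//.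
  apply: le_trans (ltW M1).
  by case/andP: (@powR_unit_interval (s - 1) y ltac:(lra) ltac:(lra)).
Qed.

Lemma volterra_powR (c s x : R) : 1 <= s -> 0 <= x <= 1 ->
  \int[mu]_(y in `[0, x `^ alpha]) (c * y `^ (s - 1)) =
    c / s * x `^ (alpha * s).
Proof.
move=> s1 x01.
have xa01 := powR_unit_interval (ltW alpha0) x01.
rewrite RintegralZl//; last by apply: powR_integrable => //; case/andP: xa01.
rewrite integral_powR//.
by rewrite -powRrM mulrA mulrAC.
Qed.

Lemma iter_volterra_integrable n (f : measurableTypeR R -> R) :
  mu.-integrable setT (EFin \o f) -> mu.-integrable setT (EFin \o iter n T f).
Proof. by move=> intf; elim: n => //= n; exact: volterra_integrable. Qed.

(** One plus the exponent of x in the n-th iterate of the operator on the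
    constant 1, hence the divisor produced by the next integration. *)
Definition geom_sum n : R := \sum_(j < n.+1) alpha ^+ j.

Lemma geom_sumS n : geom_sum n.+1 = alpha * geom_sum n + 1.
Proof.
rewrite /geom_sum big_ord_recl expr0 addrC mulr_sumr; congr (_ + _).
by apply: eq_bigr => i _; rewrite -exprS.
Qed.

Lemma geom_sum_ge1 n : 1 <= geom_sum n.
Proof.
rewrite /geom_sum big_ord_recl expr0 lerDl sumr_ge0// => i _.
by rewrite exprn_ge0// ltW.
Qed.

Definition prod_inv_geom n : R := \prod_(k < n) (geom_sum k)^-1.

Lemma prod_inv_geomS n : prod_inv_geom n.+1 = prod_inv_geom n / geom_sum n.
Proof. exact: big_ord_recr. Qed.

Lemma geom_sum_gt0 n : 0 < geom_sum n.
Proof. by rewrite (lt_le_trans ltr01)// geom_sum_ge1. Qed.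

Lemma prod_inv_geom_gt0 n : 0 < prod_inv_geom n.
Proof. by apply: prodr_gt0 => k _; rewrite invr_gt0 geom_sum_gt0. Qed.

Lemma iter_volterra_cst1 n x : 0 <= x <= 1 ->
  iter n T (cst 1) x = prod_inv_geom n * x `^ (geom_sum n - 1).
Proof.
elim: n x => [|n IH] x x01 /=.
  by rewrite /prod_inv_geom /geom_sum big_ord0 big_ord1 expr0 subrr powRr0 mulr1.
have /andP[_ xa1] := powR_unit_interval (ltW alpha0) x01.
rewrite prod_inv_geomS geom_sumS addrK -volterra_powR ?geom_sum_ge1//.
apply: eq_Rintegral => y; rewrite inE/= in_itv/= => /andP[y0 yx].
by rewrite IH// y0 (le_trans yx).
Qed.

(** Positivity of the operator: a bound by the constant c propagates to the
    bound by c times the iterates of the constant 1. *)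
Lemma iter_volterra_le n (f : measurableTypeR R -> R) (c : R) x :
  mu.-integrable setT (EFin \o f) ->
  (forall y, 0 <= y <= 1 -> `|f y| <= c) -> 0 <= x <= 1 ->
  `|iter n T f x| <= c * prod_inv_geom n * x `^ (geom_sum n - 1).
Proof.
move=> intf fc; elim: n x => [|n IH] x x01 /=.
  by rewrite /prod_inv_geom /geom_sum big_ord0 big_ord1 expr0 subrr powRr0 !mulr1 fc.
have /andP[_ xa1] := powR_unit_interval (ltW alpha0) x01.
rewrite prod_inv_geomS geom_sumS addrK mulrA -volterra_powR ?geom_sum_ge1//.
have intI : mu.-integrable `[0, x `^ alpha] (EFin \o iter n T f).
  apply: (integrableS measurableT (measurable_itvR _)) => //.
  exact: iter_volterra_integrable.
apply: (le_trans (le_normr_Rintegral (measurable_itvR _) intI)).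
apply: le_Rintegral => //.
- exact: integrable_abse intI.
- have := integrableZl (measurable_itvR _) (c * prod_inv_geom n)
    (powR_integrable (geom_sum_ge1 n) xa1).
  by apply.
- move=> y; rewrite /= in_itv/= => /andP[y0 yx].
  by rewrite IH// y0 (le_trans yx).
Qed.

(** * Bounds of the operator norm *)

(** The first application of the operator is spent on making the function
    bounded, whence the shift of the index. *)
Lemma opnorm_le p n : 1 < p ->
  (opnorm mu p%:E (iter n.+1 T) <= (prod_inv_geom n)%:E)%E.
Proof.
move=> p1; apply: ub_ereal_sup => _ [f [fp f1] <-].
have p0 : 0 < p by lra.
have intf : mu.-integrable setT (EFin \o f).
  apply/Lfun1_integrable; apply: Lfun_subset fp => //.
  - by rewrite lee_fin ltW.
  - by rewrite lebesgue01_setT.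
  - by rewrite lee_fin ltW.
have mf : measurable_fun setT f by apply/measurable_EFinP; case/integrableP: intf.
have Tf1 x : `|T f x| <= 1.
  apply: (le_trans (volterra_le_norm1 x intf)).
  have h := le_trans (Lnorm1_le_Lnorm lebesgue01_setT p1 mf) f1.
  by rewrite -lee_fin fineK// ge0_fin_numE ?Lnorm_ge0// (le_lt_trans h) ?ltry.
have intT := volterra_integrable intf.
apply: (Lnorm_le_ae lebesgue01_setT) => //.
- exact/ltW/prod_inv_geom_gt0.
- have := iter_volterra_integrable n.+1 intf.
  by move=> /integrableP[/measurable_EFinP].
- have aeF : Filter (almost_everywhere mu) := ae_filter_ringOfSetsType mu.
  apply: filterS (@ae_unit_interval R) => x; rewrite in_itv/= => x01.
  rewrite -[X in `|X|]/(iter n.+1 T f x) iterSr.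
  apply: le_trans (iter_volterra_le n intT (fun y _ => Tf1 y) x01) _.
  rewrite mul1r ler_piMr ?(ltW (prod_inv_geom_gt0 _))//.
  have s0 : 0 <= geom_sum n - 1 by rewrite subr_ge0 geom_sum_ge1.
  by case/andP: (powR_unit_interval s0 x01).
Qed.

(** The constant 1 is the test function; integrating its n-th iterate over [0,1]
    contributes the factor 1 / geom_sum n, whence the shift of the index. *)
Lemma opnorm_ge p n : 1 < p ->
  ((prod_inv_geom n.+1)%:E <= opnorm mu p%:E (iter n T))%E.
Proof.
move=> p1.
have m1 : measurable_fun setT (cst 1 : measurableTypeR R -> R).
  exact: measurable_cst.
have N1 : ('N[mu]_p%:E[EFin \o cst 1%R] = 1)%E.
  by rewrite [LHS](Lnorm_cst1 mu p) lebesgue01_setT poweR1r.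
have int1 : mu.-integrable setT (EFin \o (cst 1 : measurableTypeR R -> R)).
  by apply: (bounded_integrable (c := 1) lebesgue01_setT m1) => x; rewrite normr1.
have intT := iter_volterra_integrable n int1.
have /integrableP[mT finT] := intT.
apply: (@le_trans _ _ ('N[mu]_p%:E[EFin \o iter n T (cst 1%R)])%E); last first.
  apply: ereal_sup_ubound; exists (cst 1) => //; split; last by rewrite N1.
  by rewrite inE; apply/andP; split; rewrite inE//= /finite_norm N1 ltry.
apply: le_trans (Lnorm1_le_Lnorm lebesgue01_setT p1 _); last first.
  exact/measurable_EFinP.
rewrite Lnorm1.
pose h (x : measurableTypeR R) := prod_inv_geom n * x `^ (geom_sum n - 1).
have inth : mu.-integrable `[0, 1] (EFin \o h).
  have := integrableZl (measurable_itvR _) (prod_inv_geom n)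
    (powR_integrable (geom_sum_ge1 n) (lexx 1)).
  by apply.
have mabs := measurableT_comp (@abse_measurable _ setT) mT.
have sub := ge0_subset_integral mu (measurable_itvR `[0, 1]) measurableT mabs.
apply: (le_trans _ (sub _ _)) => //; last by move=> x _; exact: abse_ge0.
rewrite (eq_integral (EFin \o h)); last first.
  move=> x; rewrite inE/= in_itv/= => x01.
  rewrite iter_volterra_cst1// ger0_norm// mulr_ge0 ?powR_ge0//.
  exact/ltW/prod_inv_geom_gt0.
rewrite -[leRHS]fineK; last exact: (integrable_fin_num (measurable_itvR _) inth).
rewrite lee_fin -[leRHS]/(\int[mu]_(x in `[0, 1]) h x).
have := @volterra_powR (prod_inv_geom n) _ 1 (geom_sum_ge1 n) ltac:(lra).
by rewrite powR1 => ->; rewrite mulr1 prod_inv_geomS.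
Qed.

End Volterra.

(** * Sums of logarithms *)

Section Logarithms.
Context {R : realType}.
Variable alpha : R.
Hypothesis alpha0 : 0 < alpha.
Notation g := (@geom_sum R alpha).

Definition log_sum n : R := \sum_(k < n) ln (g k).

Lemma log_sum0 : log_sum 0 = 0.
Proof. exact: big_ord0. Qed.

Lemma log_sumS n : log_sum n.+1 = log_sum n + ln (g n).
Proof. exact: big_ord_recr. Qed.

Lemma ln_prod_inv_geom n : ln (prod_inv_geom alpha n) = - log_sum n.
Proof.
elim: n => [|n IH]; first by rewrite /prod_inv_geom big_ord0 ln1 log_sum0 oppr0.
rewrite prod_inv_geomS log_sumS ln_div ?posrE ?prod_inv_geom_gt0 ?geom_sum_gt0// IH.
by rewrite opprD.
Qed.

Lemma geom_sum_nondecreasing n : g n <= g n.+1.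
Proof. by rewrite /geom_sum [leRHS]big_ord_recr lerDl exprn_ge0// ltW. Qed.

(** Compared with the product of index n.+1, the upper bound of the norm lacks the
    factor 1 / g n and the lower bound has the extra factor 1 / g n.+1; since g
    is nondecreasing, ln (g n.+1) covers both. *)
Lemma ln_opnorm_bound p n : 1 < p ->
  `|ln (fine (opnorm (lebesgue01 R) p%:E (iter n.+1 (volterra alpha))))
     + log_sum n.+1| <= ln (g n.+1).
Proof.
move=> p1.
have ub := opnorm_le alpha0 n p1; have lb := opnorm_ge alpha0 n.+1 p1.
set N := opnorm _ _ _ in ub lb *.
have Nfin : N \is a fin_num.
  by rewrite fin_real// (lt_le_trans _ lb) ?ltNyr//= (le_lt_trans ub) ?ltry.
rewrite -(fineK Nfin) !lee_fin in ub lb.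
have N0 : 0 < fine N by exact: lt_le_trans (prod_inv_geom_gt0 alpha0 _) lb.
move: ub lb; rewrite -ler_ln ?posrE ?prod_inv_geom_gt0//.
rewrite -[prod_inv_geom _ _ <= _]ler_ln ?posrE ?prod_inv_geom_gt0//.
rewrite !ln_prod_inv_geom !log_sumS => ub lb.
have gg : ln (g n) <= ln (g n.+1).
  by rewrite ler_ln ?posrE ?geom_sum_gt0//; exact: geom_sum_nondecreasing.
have g0 : 0 <= ln (g n.+1) by rewrite ln_ge0// geom_sum_ge1.
by rewrite ler_norml; apply/andP; split; lra.
Qed.

Lemma geom_sum_telescope n : g n * (1 - alpha) = 1 - alpha ^+ n.+1.
Proof.
elim: n => [|n IH]; first by rewrite /geom_sum big_ord1 expr0 expr1 mul1r.
by rewrite geom_sumS mulrDl -mulrA IH [alpha ^+ n.+2]exprS; ring.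
Qed.

(** The defect from n times - ln (1 - alpha) is the sum of the
    ln (1 - alpha^(k+1)), each at least - alpha^(k+1) / (1 - alpha) because
    - ln (1 - x) = ln (1 + x / (1 - x)) <= x / (1 - x), where
    1 - x >= 1 - alpha. *)
Lemma log_sum_lt1 n : alpha < 1 ->
  - (n%:R * ln (1 - alpha)) - (1 - alpha) ^- 2 <= log_sum n
    <= - (n%:R * ln (1 - alpha)).
Proof.
move=> a1; have b0 : 0 < 1 - alpha by lra.
pose K := (1 - alpha) ^- 2.
(* K (1 - alpha^n) is the sum over k < n of alpha^k / (1 - alpha): unlike K, it
   grows at each step by enough to absorb the new term. *)
suff : - (n%:R * ln (1 - alpha)) - K * (1 - alpha ^+ n) <= log_sum n
    <= - (n%:R * ln (1 - alpha)).
  move=> /andP[lb ->]; rewrite andbT (le_trans _ lb)// lerD2l lerN2.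
  rewrite ler_piMr//; first by rewrite invr_ge0 exprn_ge0// ltW.
  by rewrite gerBl exprn_ge0// ltW.
elim: n => [|n /andP[lb ub]].
  by rewrite log_sum0 mul0r expr0; apply/andP; split; lra.
have x0 : 0 < alpha ^+ n.+1 by exact: exprn_gt0.
have xa : alpha ^+ n.+1 <= alpha.
  by rewrite exprS ler_piMr ?(ltW alpha0)// exprn_ile1// ltW.
have y0 : 0 < 1 - alpha ^+ n.+1 by lra.
have lnE : ln (g n) = ln (1 - alpha ^+ n.+1) - ln (1 - alpha).
  by rewrite -ln_div ?posrE// -geom_sum_telescope mulfK// gt_eqF.
have ln_le : ln (1 - alpha ^+ n.+1) <= 0 by rewrite ln_le0//; lra.
have ln_ge : - (alpha ^+ n.+1 / (1 - alpha)) <= ln (1 - alpha ^+ n.+1).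
  rewrite lerNl -lnV ?posrE//.
  apply: le_trans (_ : alpha ^+ n.+1 / (1 - alpha ^+ n.+1) <= _); last first.
    by rewrite ler_pM2l// lef_pV2 ?posrE//; lra.
  rewrite [X in ln X](_ : _ = 1 + alpha ^+ n.+1 / (1 - alpha ^+ n.+1));
    last by field; lra.
  by rewrite le_ln1Dx// (lt_trans (ltrN10 _))// divr_gt0.
have Kn : alpha ^+ n.+1 / (1 - alpha) <= K * (alpha ^+ n - alpha ^+ n.+1).
  rewrite (_ : K * _ = alpha ^+ n / (1 - alpha)); last first.
    by rewrite /K [alpha ^+ n.+1]exprS; field; lra.
  rewrite ler_pM2r ?invr_gt0// exprS ler_piMl ?exprn_ge0// ltW//.
rewrite log_sumS lnE -natr1 mulrDl mul1r.
apply/andP; split; last lra.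
have -> : K * (1 - alpha ^+ n.+1) =
    K * (1 - alpha ^+ n) + K * (alpha ^+ n - alpha ^+ n.+1) by ring.
lra.
Qed.

(** The elementary form of Stirling's formula: the sum is ln n!, and the
    induction step of the lower bound is n ln (1 + 1/n) <= 1. *)
Lemma log_sum_eq1 n : alpha = 1 ->
  n%:R * ln n%:R - n%:R <= log_sum n <= n%:R * ln n%:R.
Proof.
move=> a1.
have gE k : g k = k.+1%:R.
  rewrite /geom_sum a1; under eq_bigr do rewrite expr1n.
  by rewrite sumr_const card_ord.
elim: n => [|n /andP[lb ub]].
  by rewrite log_sum0 mul0r subr0 lexx.
rewrite log_sumS gE -natr1 mulrDl mul1r.
case: n lb ub => [|n] lb ub.
  by rewrite log_sum0 add0r ln1 mulr0; apply/andP; split; lra.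
have n0 : 0 < n.+1%:R :> R by rewrite ltr0n.
have nn : ln n.+1%:R <= ln (n.+1%:R + 1) :> R.
  by rewrite ler_ln ?posrE ?addr_gt0// lerDl.
have lnn : ln (n.+1%:R + 1) - ln n.+1%:R <= n.+1%:R^-1 :> R.
  rewrite -ln_div ?posrE ?addr_gt0// mulrDl divff ?gt_eqF// mul1r.
  by rewrite le_ln1Dx// (lt_trans (ltrN10 _))// invr_gt0.
have := ler_wpM2l (ltW n0) lnn; rewrite divff ?gt_eqF// => lnn1.
have := ler_wpM2l (ltW n0) nn => nn1.
by apply/andP; split; lra.
Qed.

Lemma geom_sum_gt1_bound n : 1 < alpha ->
  n%:R * ln alpha <= ln (g n) <= n%:R * ln alpha + ln (alpha / (alpha - 1)).
Proof.
move=> a1; have b0 : 0 < alpha - 1 by lra.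
have an0 := exprn_gt0 n alpha0.
rewrite mulr_natl -lnXn// -lnM ?posrE ?divr_gt0//.
rewrite !ler_ln ?posrE ?geom_sum_gt0// ?mulr_gt0 ?invr_gt0//; apply/andP; split.
  rewrite /geom_sum big_ord_recr/= lerDr sumr_ge0// => i _.
  by rewrite exprn_ge0// ltW.
rewrite mulrA ler_pdivlMr// -exprSr.
by have := geom_sum_telescope n; lra.
Qed.

Lemma log_sum_gt1 n : 1 < alpha ->
  1 / 2 * n%:R ^+ 2 * ln alpha - n%:R * ln alpha <= log_sum n
    <= 1 / 2 * n%:R ^+ 2 * ln alpha + n%:R * ln (alpha / (alpha - 1)).
Proof.
move=> a1; have c0 : 0 < ln alpha by rewrite ln_gt0.
suff : n%:R * (n%:R - 1) / 2 * ln alpha <= log_sum n <=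
    n%:R * (n%:R - 1) / 2 * ln alpha + n%:R * ln (alpha / (alpha - 1)).
  have : 0 <= n%:R * ln alpha by rewrite mulr_ge0// ltW.
  by move=> nc /andP[lb ub]; apply/andP; split; lra.
elim: n => [|n /andP[lb ub]].
  by rewrite log_sum0 !mul0r addr0 lexx.
have /andP[lb' ub'] := geom_sum_gt1_bound n a1.
by rewrite log_sumS -natr1; apply/andP; split; lra.
Qed.

End Logarithms.

(** * Asymptotics of the norm *)

Lemma eqaddo_bounded (R : realType) (u v : nat -> R^o) (c : R) :
  (forall n, `|u n.+1 - v n.+1| <= c) ->
  u = v +o_\oo (fun n => n%:R : R^o).
Proof.
move=> uv; apply/eqaddoP => e e0.
near=> n; have n0 : (0 < n)%N by near: n; exact: nbhs_infty_gt.
rewrite -[(u - v) n]/(u n - v n) -(prednK n0).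
apply: le_trans (uv _) _; rewrite prednK// ger0_norm ?ler0n//.
rewrite -ler_pdivrMl//; near: n; exact: nbhs_infty_ger.
Unshelve. all: by end_near. Qed.

Lemma eqaddO_linear (R : realType) (u v : nat -> R^o) (c : R) :
  (forall n, `|u n.+1 - v n.+1| <= c * n.+1%:R) ->
  u = v +O_\oo (fun n => n%:R : R^o).
Proof.
move=> uv; apply/eqaddOP; apply/bigO_exP.
exists (`|c| + 1); first by rewrite ltr_wpDl.
near=> n; have n0 : (0 < n)%N by near: n; exact: nbhs_infty_gt.
rewrite -[(u - v) n]/(u n - v n) -(prednK n0).
apply: le_trans (uv _) _; rewrite prednK// (@ger0_norm _ n%:R) ?ler0n//.
by rewrite ler_wpM2r// ?ler0n// (le_trans (ler_norm _))// lerDl.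
Unshelve. all: by end_near. Qed.

Theorem theorem4 (R : realType) (p alpha : R) (hp : 1 < p) (halpha : 0 < alpha) :
  let logT := (fun n : nat =>
    ln (fine (opnorm (lebesgue01 R) p%:E (iter n (volterra alpha))))) : nat -> R^o in
  let idn := (fun n : nat => n%:R) : nat -> R^o in
  [/\ alpha < 1 ->
        logT = (fun n : nat => n%:R * ln (1 - alpha)) +o_\oo idn,
      alpha = 1 ->
        logT = (fun n : nat => - (n%:R * ln n%:R)) +O_\oo idn
    & 1 < alpha ->
        logT = (fun n : nat => - (1 / 2 * n%:R ^+ 2 * ln alpha)) +O_\oo idn].
Proof.
move=> logT idn.
(* It remains to compare the sum of logarithms with the claimed main term f. *)
have error (f : nat -> R) n (b : R) : `|log_sum alpha n.+1 + f n.+1| <= b ->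
    `|logT n.+1 - f n.+1| <= b + ln (geom_sum alpha n.+1).
  move=> fb.
  have -> : logT n.+1 - f n.+1 =
    - (log_sum alpha n.+1 + f n.+1) + (logT n.+1 + log_sum alpha n.+1) by ring.
  apply: le_trans (ler_normD _ _) _; rewrite normrN lerD//.
  exact: ln_opnorm_bound.
split=> a1.
- apply: (@eqaddo_bounded _ _ _ ((1 - alpha) ^- 2 - ln (1 - alpha))) => n.
  apply: le_trans (error (fun n => n%:R * ln (1 - alpha)) n ((1 - alpha) ^- 2) _) _.
    have /andP[lb ub] := log_sum_lt1 halpha n.+1 a1.
    have k0 : 0 <= (1 - alpha) ^- 2 by rewrite invr_ge0 sqr_ge0.
    by rewrite ler_norml; apply/andP; split; lra.
  rewrite lerD2l -lnV ?posrE ?subr_gt0//.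
  rewrite ler_ln ?posrE ?geom_sum_gt0 ?invr_gt0 ?subr_gt0// -[leRHS]mul1r.
  by rewrite ler_pdivlMr ?subr_gt0// geom_sum_telescope gerBl exprn_ge0// ltW.
- apply: (@eqaddO_linear _ _ _ 2) => n.
  apply: le_trans (error (fun n => - (n%:R * ln n%:R)) n n.+1%:R _) _.
    have /andP[lb ub] := log_sum_eq1 n.+1 a1.
    by rewrite ler_norml; apply/andP; split; lra.
  rewrite mulr_natl mulr2n lerD2l.
  have -> : geom_sum alpha n.+1 = 1 + n.+1%:R.
    rewrite /geom_sum a1; under eq_bigr do rewrite expr1n.
    by rewrite sumr_const card_ord -[LHS]natr1 addrC.
  by rewrite le_ln1Dx// (lt_trans (ltrN10 _))// ltr0n.
- pose c := ln alpha; pose q := ln (alpha / (alpha - 1)).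
  have c0 : 0 < c by rewrite ln_gt0.
  have q0 : 0 <= q by rewrite ln_ge0// ler_pdivlMr ?subr_gt0// mul1r gerBl.
  apply: (@eqaddO_linear _ _ _ ((c + q) + (c + q))) => n.
  have n1 : 1 <= n.+1%:R :> R by rewrite ler1n.
  have nc : 0 <= n.+1%:R * c by rewrite mulr_ge0// ltW.
  have nq : q <= n.+1%:R * q by rewrite ler_peMl.
  apply: le_trans (error (fun n => - (1 / 2 * n%:R ^+ 2 * ln alpha)) n
    (n.+1%:R * (c + q)) _) _.
    have /andP[lb ub] := log_sum_gt1 halpha n.+1 a1.
    by rewrite ler_norml -/c in lb ub *; rewrite -/q in ub; apply/andP; split; lra.
  have /andP[_ ub] := geom_sum_gt1_bound halpha n.+1 a1.
  by rewrite -/c -/q in ub; lra.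
Qed.
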